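(* Let $\beta(s)$ be a curve in $\mathbb{E}^m$ parametrized by arclength $s$. If $\beta$ is neither (an open part of) a line nor (an open part of) a circle, then the Laplace transformation of $\beta$ is a harmonic map if and only if the first and second Frenet curvature functions of $\beta$ satisfy the equation $$\kappa_1'(2\kappa_1^3 +\kappa_1'')+\kappa_1 \kappa_2(\kappa_1' \kappa_2+\kappa_1\kappa_2') = 0.$$ In particular, if $\beta$ is a planar curve, then the Laplace transformation of $\beta$ is a harmonic map if and only if the curvature function $\kappa$ of $\beta$ satisfies the differential equation $\kappa''=-2\kappa^3$.
   Context: Curves are smooth and defined on an open interval. For an arclength-parametrized curve the Laplace operator is $\Delta=-\frac{d^2}{ds^2}$; the Laplace map is $L(s)=-\beta''(s)$, and the Laplace transformation $\mathcal L$ is $L$ regarded as a map from the curve onto its image (with the metric induced from $\mathbb{E}^m$). $\mathcal L$ is a harmonic map iff the component of $\Delta L=-L''$ in the direction of $dL(\frac{d}{ds})=L'$ vanishes identically. The Frenet curvatures are defined by $\beta_1=\beta'$, $\kappa_1=\|\beta_1'\|$, $\beta_1'=\kappa_1\beta_2$ where $\kappa_1\neq0$, $\kappa_2=\|\beta_2'+\kappa_1\beta_1\|$ (the displayed equation is understood where these are defined). For a planar curve $\kappa$ is the (signed) plane curvature and $\kappa_2=0$. In the ''in particular'' statement $\beta$ is still assumed to be neither (an open part of) a line nor of a circle. *)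

(* Defs.v *)
From HB Require Import structures.
From mathcomp Require Import all_boot all_order all_algebra.
From mathcomp Require Import all_classical all_reals all_analysis.

Set Implicit Arguments.
Unset Strict Implicit.
Unset Printing Implicit Defensive.

Import Order.TTheory GRing.Theory Num.Theory.
Import numFieldNormedType.Exports.

Local Open Scope classical_set_scope.
Local Open Scope ring_scope.

(* E^m is 'rV[R]_m with [dot] and [enorm]. The library norm `|x| on 'rV[R]_m
   is the sup norm: it is used only through the topology and the derivatives,
   which are the same for both norms. *)

Definition dot {R : realType} {m : nat} (x y : 'rV[R]_m) : R :=
  \sum_(i < m) x 0 i * y 0 i.

Definition enorm {R : realType} {m : nat} (x : 'rV[R]_m) : R :=
  Num.sqrt (dot x x).

(* Orthogonal projection of x on the line spanned by w; it is 0 when w = 0. *)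
Definition component_along {R : realType} {m : nat} (w x : 'rV[R]_m) :
    'rV[R]_m :=
  (dot x w / dot w w) *: w.

(* Curves on an open interval I are total functions R -> 'rV[R]_m whose values
   outside I are irrelevant: since I is open, all the derivatives at points of
   I depend only on the restriction to I. *)

Definition smooth_on {R : realType} {m : nat} (I : set R)
    (f : R -> 'rV[R]_m) : Prop :=
  forall (n : nat) (s : R), I s -> derivable f^`(n)%classic s 1.

Definition arclength_on {R : realType} {m : nat} (I : set R)
    (beta : R -> 'rV[R]_m) : Prop :=
  forall s, I s -> enorm (beta^`()%classic s) = 1.

Definition line {R : realType} {m : nat} (p v : 'rV[R]_m) : set 'rV[R]_m :=
  [set x | exists t : R, x = p + t *: v].

Definition orthonormal_pair {R : realType} {m : nat} (u v : 'rV[R]_m) : Prop :=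
  [/\ enorm u = 1, enorm v = 1 & dot u v = 0].

Definition affine_plane {R : realType} {m : nat} (p u v : 'rV[R]_m) :
    set 'rV[R]_m :=
  [set x | exists a b : R, x = p + a *: u + b *: v].

Definition circle {R : realType} {m : nat} (p u v : 'rV[R]_m) (r : R) :
    set 'rV[R]_m :=
  affine_plane p u v `&` [set x | enorm (x - p) = r].

(* For a unit-speed curve on an interval, having its image inside a line
   (a circle) is the same as being an open part of that line (circle). *)

Definition part_of_line {R : realType} {m : nat} (I : set R)
    (beta : R -> 'rV[R]_m) : Prop :=
  exists p v : 'rV[R]_m, v != 0 /\ beta @` I `<=` line p v.

Definition part_of_circle {R : realType} {m : nat} (I : set R)
    (beta : R -> 'rV[R]_m) : Prop :=
  exists (p u v : 'rV[R]_m) (r : R),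
    [/\ orthonormal_pair u v, 0 < r & beta @` I `<=` circle p u v r].

(* Sign convention Delta = - d^2/ds^2. *)
Definition laplacian {R : realType} {m : nat} (f : R -> 'rV[R]_m) :
    R -> 'rV[R]_m :=
  fun s => - f^`(2)%classic s.

Definition laplace_map {R : realType} {m : nat} (beta : R -> 'rV[R]_m) :
    R -> 'rV[R]_m :=
  laplacian beta.

(* The tension field of L, as a map onto its image with the induced metric,
   is minus the component of Delta L tangent to the image, i.e. along
   dL(d/ds) = L'. *)
Definition harmonic_laplace {R : realType} {m : nat} (I : set R)
    (beta : R -> 'rV[R]_m) : Prop :=
  let L := laplace_map beta in
  forall s, I s -> component_along (L^`()%classic s) (laplacian L s) = 0.

Definition frenet1 {R : realType} {m : nat} (beta : R -> 'rV[R]_m) :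
    R -> 'rV[R]_m :=
  beta^`()%classic.

Definition kappa1 {R : realType} {m : nat} (beta : R -> 'rV[R]_m) : R -> R :=
  fun s => enorm ((frenet1 beta)^`()%classic s).

(* Meaningful only where kappa1 != 0. *)
Definition frenet2 {R : realType} {m : nat} (beta : R -> 'rV[R]_m) :
    R -> 'rV[R]_m :=
  fun s => (kappa1 beta s)^-1 *: (frenet1 beta)^`()%classic s.

(* Meaningful only where kappa1 != 0. *)
Definition kappa2 {R : realType} {m : nat} (beta : R -> 'rV[R]_m) : R -> R :=
  fun s =>
    enorm ((frenet2 beta)^`()%classic s + kappa1 beta s *: frenet1 beta s).

(* The displayed differential equation involves kappa1', kappa1'' and kappa2'.
   Where kappa1 != 0, kappa1 is smooth and kappa2 is defined; kappa2, being a
   norm, may still fail to be differentiable at its zeros. *)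
Definition frenet_equation {R : realType} {m : nat} (I : set R)
    (beta : R -> 'rV[R]_m) : Prop :=
  let k1 := kappa1 beta in
  let k2 := kappa2 beta in
  forall s, I s -> k1 s != 0 -> derivable k2 s 1 ->
    k1^`()%classic s * (2 * k1 s ^+ 3 + k1^`(2)%classic s)
    + k1 s * k2 s * (k1^`()%classic s * k2 s + k1 s * k2^`()%classic s) = 0.

(* The rotation by a right angle in the plane spanned by the orthonormal pair
   (u, v), oriented by it: u |-> v, v |-> - u. *)
Definition rot {R : realType} {m : nat} (u v x : 'rV[R]_m) : 'rV[R]_m :=
  dot x u *: v - dot x v *: u.

(* Signed curvature of a unit-speed curve in a plane directed by (u, v):
   T' = kappa N with T = beta' and N = rot T. *)
Definition plane_curvature {R : realType} {m : nat} (u v : 'rV[R]_m)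
    (beta : R -> 'rV[R]_m) : R -> R :=
  fun s => dot (beta^`(2)%classic s) (rot u v (beta^`()%classic s)).

(* Main.v *)
(** The Laplace transformation is harmonic iff [beta''''] is orthogonal to
    [beta'''], i.e. iff [|beta'''|^2] has zero derivative. Where
    [kappa1 != 0], [|beta'''|^2 = kappa1^2 kappa2^2 + kappa1'^2 + kappa1^4],
    whose derivative is twice the left-hand side of the Frenet equation.
    The points where the Frenet equation says nothing are harmless: by
    continuity, a failure of orthogonality propagates to an open set; there
    either [kappa1 = 0] identically, so [beta''' = 0], or [kappa2] is nowhere
    differentiable on a nonempty open set, hence vanishes there (as the square
    root of a smooth function), hence is differentiable.

    For a plane curve, [<beta'''', beta'''> = k' (k'' + 2 k^3)] and
    [|beta'''|^2 = k'^2 + k^4]. Suppose that the former vanishes identically.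
    Then [|beta'''|^2] is a constant [C], and where [E := k'' + 2 k^3] is
    nonzero one has [k' = k'' = 0], so [E^4 = 16 C^3]. The continuous function
    [E^4] has at most one nonzero value, so [E] is either identically zero or
    nowhere zero; in the latter case [k' = 0] everywhere, so [k] is a nonzero
    constant and [beta] is part of a circle. *)

Require Import Defs.
From HB Require Import structures.
From mathcomp Require Import all_boot all_order all_algebra.
From mathcomp Require Import all_classical all_reals all_analysis.
From mathcomp Require Import ring lra.

Set Implicit Arguments.
Unset Strict Implicit.
Unset Printing Implicit Defensive.

Import Order.TTheory GRing.Theory Num.Theory.
Import numFieldNormedType.Exports.

Local Open Scope classical_set_scope.
Local Open Scope ring_scope.

(** * Euclidean inner product and norm *)

Lemma dotC {R : realType} {m : nat} (x y : 'rV[R]_m) : dot x y = dot y x.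
Proof. by apply: eq_bigr => i _; rewrite mulrC. Qed.

Lemma dotDl {R : realType} {m : nat} (x y z : 'rV[R]_m) :
  dot (x + y) z = dot x z + dot y z.
Proof. by rewrite -big_split; apply: eq_bigr => i _; rewrite mxE mulrDl. Qed.

Lemma dotZl {R : realType} {m : nat} (a : R) (x y : 'rV[R]_m) :
  dot (a *: x) y = a * dot x y.
Proof. by rewrite mulr_sumr; apply: eq_bigr => i _; rewrite mxE mulrA. Qed.

Lemma dotNl {R : realType} {m : nat} (x y : 'rV[R]_m) : dot (- x) y = - dot x y.
Proof. by rewrite -scaleN1r dotZl mulN1r. Qed.

Lemma dot0l {R : realType} {m : nat} (y : 'rV[R]_m) : dot 0 y = 0.
Proof. by rewrite -(scale0r y) dotZl mul0r. Qed.

Lemma dot0r {R : realType} {m : nat} (x : 'rV[R]_m) : dot x 0 = 0.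
Proof. by rewrite dotC dot0l. Qed.

Lemma dotDr {R : realType} {m : nat} (x y z : 'rV[R]_m) :
  dot z (x + y) = dot z x + dot z y.
Proof. by rewrite dotC dotDl !(dotC _ z). Qed.

Lemma dotZr {R : realType} {m : nat} (a : R) (x y : 'rV[R]_m) :
  dot x (a *: y) = a * dot x y.
Proof. by rewrite dotC dotZl dotC. Qed.

Lemma dotNr {R : realType} {m : nat} (x y : 'rV[R]_m) : dot x (- y) = - dot x y.
Proof. by rewrite dotC dotNl dotC. Qed.

Lemma dot_ge0 {R : realType} {m : nat} (x : 'rV[R]_m) : 0 <= dot x x.
Proof. by apply: sumr_ge0 => i _; rewrite -expr2 sqr_ge0. Qed.

Lemma dot_eq0 {R : realType} {m : nat} (x : 'rV[R]_m) :
  (dot x x == 0) = (x == 0).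
Proof.
apply/idP/eqP => [|->]; last by rewrite dot0l.
rewrite psumr_eq0 => [/allP x0|i _]; last by rewrite -expr2 sqr_ge0.
apply/rowP => i; rewrite mxE; apply/eqP.
by have := x0 i (mem_index_enum i); rewrite mulf_eq0 orbb.
Qed.

Lemma sqr_enorm {R : realType} {m : nat} (x : 'rV[R]_m) :
  enorm x ^+ 2 = dot x x.
Proof. exact/sqr_sqrtr/dot_ge0. Qed.

Lemma enorm_gt0 {R : realType} {m : nat} (x : 'rV[R]_m) :
  (0 < enorm x) = (x != 0).
Proof. by rewrite sqrtr_gt0 lt_def dot_ge0 andbT dot_eq0. Qed.

Lemma enorm_eq0 {R : realType} {m : nat} (x : 'rV[R]_m) :
  (enorm x == 0) = (x == 0).
Proof. by have := enorm_gt0 x; rewrite lt_def sqrtr_ge0 andbT => /negb_inj. Qed.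

Lemma enormZ {R : realType} {m : nat} (a : R) (x : 'rV[R]_m) :
  enorm (a *: x) = `|a| * enorm x.
Proof.
by rewrite /enorm dotZl dotZr mulrA -expr2 sqrtrM ?sqr_ge0// sqrtr_sqr.
Qed.

(** The degenerate case [w = 0] is consistent: the projection is then [0] and so is the inner
    product. Hence points where the Laplace map has zero velocity need no separate treatment. *)
Lemma component_along_eq0 {R : realType} {m : nat} (w x : 'rV[R]_m) :
  component_along w x = 0 <-> dot x w = 0.
Proof.
rewrite /component_along; split=> [/eqP|->]; last by rewrite mul0r scale0r.
rewrite scaler_eq0 mulf_eq0 invr_eq0 dot_eq0.
by case: eqP => [//|_]; case: eqP => [->|//]; rewrite dotC dot0l.
Qed.

(** * Differential calculus in one variable, on open sets and on intervals *)

Lemma is_derive_derive1 {R : realType} {V : normedModType R} (f : R -> V)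
    (s : R) df :
  is_derive s 1 f df -> f^`()%classic s = df.
Proof. by move=> [_ <-]; rewrite derive1E. Qed.

Lemma derivable_is_derive1 {R : realType} {V : normedModType R} (f : R -> V)
    (s : R) :
  derivable f s 1 -> is_derive s 1 f (f^`()%classic s).
Proof. by move=> /derivableP; rewrite derive1E. Qed.

Lemma derivable1_continuous {R : realType} {V : normedModType R}
    (f : R -> V) (s : R) : derivable f s 1 -> {for s, continuous f}.
Proof. by move=> /derivable1_diffP/differentiable_continuous. Qed.

Lemma open_near {R : realType} {I : set R} {s : R} :
  open I -> I s -> \forall t \near s, I t.
Proof. by move=> oI Is; apply: open_nbhs_nbhs. Qed.

Lemma is_derive_on_congr {R : realType} {V : normedModType R} (I : set R)
    (f g : R -> V) (s : R) df :
  open I -> (forall t, I t -> f t = g t) -> I s ->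
  is_derive s 1 f df -> is_derive s 1 g df.
Proof.
move=> oI fg Is; apply: near_eq_is_derive.
by apply: filterS (open_near oI Is) => t; exact: fg.
Qed.

(** Used to differentiate an identity that holds on an open set: each side is differentiated by its
    own rules, and the two results agree. *)
Lemma is_derive_on_unique {R : realType} {V : normedModType R} (I : set R)
    (f g : R -> V) (s : R) df dg :
  open I -> (forall t, I t -> f t = g t) -> I s ->
  is_derive s 1 f df -> is_derive s 1 g dg -> df = dg.
Proof.
move=> oI fg Is /(is_derive_on_congr oI fg Is)/is_derive_derive1 <-.
by move=> /is_derive_derive1.
Qed.

Lemma is_derive_mul {R : realType} (f g : R -> R) (s : R) df dg :
  is_derive s 1 f df -> is_derive s 1 g dg ->
  is_derive s 1 (fun t => f t * g t) (df * g s + f s * dg).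
Proof.
move=> hf hg; apply: is_derive_eq (is_deriveM hf hg) _.
by rewrite addrC [df * _]mulrC.
Qed.

Lemma is_derive_exprn {R : realType} (f : R -> R) n (s : R) df :
  is_derive s 1 f df ->
  is_derive s 1 (fun t => f t ^+ n) (n%:R * f s ^+ n.-1 * df).
Proof.
move=> hf; rewrite (_ : (fun t => _) = f ^+ n); first exact: is_deriveX.
by apply/funext => t; rewrite fctE.
Qed.

Lemma is_derive_inv {R : realType} (f : R -> R) (s : R) df :
  f s != 0 -> is_derive s 1 f df ->
  is_derive s 1 (fun t => (f t)^-1) (- (f s) ^- 2 * df).
Proof. by move=> fs0 hf; exact: is_deriveV. Qed.

Lemma is_derive_sqrt {R : realType} (f : R -> R) (s : R) df :
  0 < f s -> is_derive s 1 f df ->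
  is_derive s 1 (fun t => Num.sqrt (f t)) (df / (2 * Num.sqrt (f s))).
Proof.
move=> fs0 hf; rewrite mulrC.
exact: (@is_derive1_comp _ Num.sqrt f s _ df (is_derive1_sqrt fs0) hf).
Qed.

(** Reduces the product rules for [dot] and for scaling to the scalar product rule, coordinate by
    coordinate. *)
Lemma is_derive_rVP {R : realType} {m : nat} (f : R -> 'rV[R]_m) (s : R) df :
  is_derive s 1 f df <->
  forall j, is_derive s 1 (fun t => f t 0 j) (df 0 j).
Proof.
split=> [[hf <-] j|hf].
  apply: DeriveDef; first exact: (derivable_mxP _ _ _).1 hf 0 j.
  by rewrite derive_mx// mxE.
have df' : derivable f s 1.
  by apply/derivable_mxP => i j; rewrite ord1; case: (hf j).
apply: DeriveDef => //; rewrite derive_mx//; apply/rowP => j.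
by rewrite mxE; case: (hf j).
Qed.

Lemma is_derive_dot {R : realType} {m : nat} (f g : R -> 'rV[R]_m)
    (s : R) df dg :
  is_derive s 1 f df -> is_derive s 1 g dg ->
  is_derive s 1 (fun t => dot (f t) (g t)) (dot df (g s) + dot (f s) dg).
Proof.
move=> /is_derive_rVP hf /is_derive_rVP hg.
rewrite (_ : (fun t => _) = \sum_(i < m) (fun t => f t 0 i * g t 0 i)).
  rewrite -big_split; apply: is_derive_sum => i.
  exact: is_derive_mul.
by apply/funext => t; rewrite fct_sumE.
Qed.

Lemma is_derive_dot_self {R : realType} {m : nat} (f : R -> 'rV[R]_m)
    (s : R) df :
  is_derive s 1 f df ->
  is_derive s 1 (fun t => dot (f t) (f t)) (2 * dot df (f s)).
Proof.
move=> hf; apply: is_derive_eq (is_derive_dot hf hf) _.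
by rewrite (dotC (f s)); ring.
Qed.

Lemma is_derive_scale {R : realType} {m : nat} (a : R -> R) (f : R -> 'rV[R]_m)
    (s : R) da df :
  is_derive s 1 a da -> is_derive s 1 f df ->
  is_derive s 1 (fun t => a t *: f t) (da *: f s + a s *: df).
Proof.
move=> ha /is_derive_rVP hf; apply/is_derive_rVP => j.
rewrite !mxE (_ : (fun t => _) = (fun t => a t * f t 0 j)).
  exact: is_derive_mul.
by apply/funext => t; rewrite mxE.
Qed.

Lemma is_derive_enorm {R : realType} {m : nat} (f : R -> 'rV[R]_m) (s : R) df :
  f s != 0 -> is_derive s 1 f df ->
  is_derive s 1 (fun t => enorm (f t)) (dot (f s) df / enorm (f s)).
Proof.
move=> fs0 hf.
have fs_gt0 : 0 < dot (f s) (f s) by rewrite -sqrtr_gt0 enorm_gt0.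
apply: is_derive_eq (is_derive_sqrt fs_gt0 (is_derive_dot_self hf)) _.
rewrite (dotC df) -/(enorm _); field.
by rewrite enorm_eq0.
Qed.

(** Mean value theorem on the segment between the two points, which stays in [I] because [I] is an
    interval. *)
Lemma is_derive_on_constant {R : realType} (I : set R) (f : R -> R) :
  is_interval I -> (forall s, I s -> is_derive s 1 f 0) ->
  forall s t, I s -> I t -> f s = f t.
Proof.
move=> iI df0 s t; wlog st : s t / s <= t => [H Is It|Is It].
  by have [/H->//|/ltW/H->] := leP s t.
have Ist x : x \in `[s, t] -> I x.
  by rewrite in_itv => /= xst; exact: iI xst.
have [x xst| |c _ /eqP] := @MVT_segment R f (fun=> 0) s t st.
- by apply/df0/Ist; apply: subset_itv_oo_cc xst.
- apply: derivable_within_continuous => x xst.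
  by have [] := df0 x (Ist x xst).
- by rewrite mul0r subr_eq0 => /eqP.
Qed.

Lemma is_derive_on_constant_rV {R : realType} {m : nat} (I : set R)
    (f : R -> 'rV[R]_m) :
  is_interval I -> (forall s, I s -> is_derive s 1 f 0) ->
  forall s t, I s -> I t -> f s = f t.
Proof.
move=> iI df0 s t Is It; apply/rowP => j.
apply: (@is_derive_on_constant R I (fun x => f x 0 j)) => // x /df0.
by move=> /is_derive_rVP/(_ j); rewrite mxE.
Qed.

(** * Derivatives of a smooth curve and harmonicity of its Laplace map *)

Lemma is_derive_smooth {R : realType} {m : nat} (I : set R)
    (beta : R -> 'rV[R]_m) n (s : R) :
  smooth_on I beta -> I s ->
  is_derive s 1 beta^`(n)%classic (beta^`(n.+1)%classic s).
Proof.
by move=> sm Is; rewrite derive1nS; exact: derivable_is_derive1 (sm n s Is).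
Qed.

Lemma is_derive_smooth_dot {R : realType} {m : nat} (I : set R)
    (beta : R -> 'rV[R]_m) n p (s : R) :
  smooth_on I beta -> I s ->
  is_derive s 1 (fun t => dot (beta^`(n)%classic t) (beta^`(p)%classic t))
    (dot (beta^`(n.+1)%classic s) (beta^`(p)%classic s) +
     dot (beta^`(n)%classic s) (beta^`(p.+1)%classic s)).
Proof.
move=> sm Is.
exact: is_derive_dot (is_derive_smooth n sm Is) (is_derive_smooth p sm Is).
Qed.

(** On [I], [L' = - beta'''], while the two signs in [Delta L = - L''] and [L = - beta''] cancel and
    give [Delta L = beta'''']. *)
Lemma harmonic_laplaceE {R : realType} {m : nat} (I : set R)
    (beta : R -> 'rV[R]_m) :
  open I -> smooth_on I beta ->
  harmonic_laplace I beta <->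
  forall s, I s -> dot (beta^`(4)%classic s) (beta^`(3)%classic s) = 0.
Proof.
move=> oI sm.
have dL s : I s -> (laplace_map beta)^`()%classic s = - beta^`(3)%classic s.
  move=> Is; apply: is_derive_derive1.
  exact: is_deriveN (is_derive_smooth 2 sm Is).
have ddL s : I s -> (laplace_map beta)^`(2)%classic s = - beta^`(4)%classic s.
  move=> Is; rewrite derive1nS; apply: is_derive_derive1.
  apply: (@is_derive_on_congr _ _ I (fun t => - beta^`(3)%classic t)) => //.
    by move=> t It; rewrite derive1n1 dL.
  exact: is_deriveN (is_derive_smooth 3 sm Is).
have eqv s : I s -> component_along ((laplace_map beta)^`()%classic s)
    (laplacian (laplace_map beta) s) = 0 <->
    dot (beta^`(4)%classic s) (beta^`(3)%classic s) = 0.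
  move=> Is; apply: (iff_trans (component_along_eq0 _ _)).
  rewrite dL// /laplacian ddL// opprK dotNr; split=> [/eqP|->].
    by rewrite oppr_eq0 => /eqP.
  exact: oppr0.
split=> [H s Is|H]; first exact/(eqv s Is)/H.
by rewrite /harmonic_laplace => s Is; exact/(eqv s Is)/H.
Qed.

(** To be read with [x], [y], [z] the first three derivatives of the curve, [k = kappa1] and
    [dk = kappa1']; then [w] is the vector whose norm is [kappa2]. The hypotheses make [w]
    orthogonal to [x] and [y], so Pythagoras applies to [z = k w + (dk / k) y - k^2 x]. *)
Lemma dot_frenet_decomposition {R : realType} {m : nat} (x y z : 'rV[R]_m)
    (k dk : R) :
  k != 0 -> dot x x = 1 -> dot x y = 0 -> dot x z = - k ^+ 2 ->
  dot y y = k ^+ 2 -> dot y z = k * dk ->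
  let w := (- k ^- 2 * dk) *: y + k^-1 *: z + k *: x in
  dot z z = k ^+ 2 * dot w w + dk ^+ 2 + k ^+ 4.
Proof.
move=> k0 xx xy xz yy yz w; rewrite /w !(dotDl, dotDr, dotZl, dotZr).
by rewrite (dotC z y) (dotC z x) (dotC y x) xx xy xz yy yz; field.
Qed.

(** * Frenet curvatures of a unit-speed curve *)

Section frenet_curvatures.
Context {R : realType} {m : nat} (I : set R) (beta : R -> 'rV[R]_m).
Hypotheses (I_open : open I) (beta_smooth : smooth_on I beta)
  (beta_arclength : arclength_on I beta).

Local Notation b n := (beta^`(n)%classic).
Local Notation k1 := (kappa1 beta).
Local Notation k2 := (kappa2 beta).
Local Notation U := (I `&` [set s | k1 s != 0]).

Lemma dot_velocity s : I s -> dot (b 1 s) (b 1 s) = 1.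
Proof. by move=> Is; rewrite -sqr_enorm (beta_arclength Is) expr1n. Qed.

Lemma dot_velocity_acceleration s : I s -> dot (b 1 s) (b 2 s) = 0.
Proof.
move=> Is; have := is_derive_on_unique I_open dot_velocity Is
  (is_derive_dot_self (is_derive_smooth 1 beta_smooth Is))
  (is_derive_cst _ _ _).
by rewrite dotC => /eqP; rewrite mulf_eq0 pnatr_eq0 => /eqP.
Qed.

Lemma dot_velocity_jerk s : I s -> dot (b 1 s) (b 3 s) = - dot (b 2 s) (b 2 s).
Proof.
move=> Is; have := is_derive_on_unique I_open dot_velocity_acceleration Is
  (is_derive_smooth_dot 1 2 beta_smooth Is) (is_derive_cst _ _ _).
by move/eqP; rewrite addrC addr_eq0 => /eqP.
Qed.

Lemma sqr_kappa1 s : k1 s ^+ 2 = dot (b 2 s) (b 2 s).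
Proof. exact: sqr_enorm. Qed.

Lemma kappa1_eq0 s : (k1 s == 0) = (b 2 s == 0).
Proof. exact: enorm_eq0. Qed.

Lemma is_derive_kappa1 s : U s ->
  is_derive s 1 k1 (dot (b 2 s) (b 3 s) / k1 s).
Proof.
move=> [Is /= k10]; rewrite kappa1_eq0 in k10.
exact: is_derive_enorm k10 (is_derive_smooth 2 beta_smooth Is).
Qed.

(** Allows identities that hold only where [kappa1] is nonzero to be differentiated there. *)
Lemma open_kappa1_neq0 : open U.
Proof.
rewrite openE => s Us; have [Is /= k10] := Us.
have k1c : {for s, continuous k1}.
  by apply: derivable1_continuous; have [] := is_derive_kappa1 Us.
by near=> t; split; near: t;
  [exact: open_near I_open Is|exact: cvgr_neq0 k1c k10].
Unshelve. all: by end_near. Qed.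

Lemma derive_kappa1 s : U s -> k1^`()%classic s = dot (b 2 s) (b 3 s) / k1 s.
Proof. by move=> Us; exact/is_derive_derive1/is_derive_kappa1. Qed.

(** On the open set [U], [kappa1'] agrees with an explicit differentiable quotient. Its derivative
    is left unevaluated, since the Frenet equation mentions [kappa1''] as such. *)
Lemma is_derive2_kappa1 s : U s ->
  is_derive s 1 k1^`()%classic (k1^`(2)%classic s).
Proof.
move=> Us; rewrite derive1nS derive1n1; apply: derivable_is_derive1.
have [Is /= k10] := Us.
have [] // := is_derive_on_congr open_kappa1_neq0
  (fun t Ut => esym (derive_kappa1 Ut)) Us
  (is_derive_mul (is_derive_smooth_dot 2 3 beta_smooth Is)
                 (is_derive_inv k10 (is_derive_kappa1 Us))).
Qed.

Lemma sqr_norm_jerk s : U s -> dot (b 3 s) (b 3 s) =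
  k1 s ^+ 2 * k2 s ^+ 2 + k1^`()%classic s ^+ 2 + k1 s ^+ 4.
Proof.
move=> Us; have [Is /= k10] := Us.
have dF : (frenet2 beta)^`()%classic s =
    (- k1 s ^- 2 * k1^`()%classic s) *: b 2 s + (k1 s)^-1 *: b 3 s.
  rewrite derive_kappa1//; apply: is_derive_derive1.
  exact: is_derive_scale (is_derive_inv k10 (is_derive_kappa1 Us))
    (is_derive_smooth 2 beta_smooth Is).
rewrite [k2 s ^+ 2]sqr_enorm dF.
have dk : dot (b 2 s) (b 3 s) = k1 s * k1^`()%classic s.
  by rewrite derive_kappa1// mulrC divfK.
apply: dot_frenet_decomposition => //.
- exact: dot_velocity.
- exact: dot_velocity_acceleration.
- by rewrite sqr_kappa1; exact: dot_velocity_jerk.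
- by rewrite sqr_kappa1.
Qed.

(** Half the derivative of the identity [sqr_norm_jerk]; differentiability of [kappa2] allows its
    right-hand side to be differentiated term by term. *)
Lemma frenet_expression s : U s -> derivable k2 s 1 ->
  k1^`()%classic s * (2 * k1 s ^+ 3 + k1^`(2)%classic s)
    + k1 s * k2 s * (k1^`()%classic s * k2 s + k1 s * k2^`()%classic s) =
  dot (b 4 s) (b 3 s).
Proof.
move=> Us /derivable_is_derive1 dk2; have [Is _] := Us.
have dk1 := is_derive_kappa1 Us; rewrite -(derive_kappa1 Us) in dk1.
have := is_derive_on_unique open_kappa1_neq0 sqr_norm_jerk Us
  (is_derive_dot_self (is_derive_smooth 3 beta_smooth Is))
  (is_deriveD (is_deriveD
     (is_derive_mul (is_derive_exprn 2 dk1) (is_derive_exprn 2 dk2))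
     (is_derive_exprn 2 (is_derive2_kappa1 Us)))
     (is_derive_exprn 4 dk1)).
rewrite /=; move: (k1 s) (k1^`()%classic s) (k1^`(2)%classic s) => x dx ddx.
move: (k2 s) (k2^`()%classic s) (dot _ _) => y dy d; lra.
Qed.

(** Solving [sqr_norm_jerk] for [kappa2^2] gives a function [q] that is differentiable at [s]; where
    it is positive, so is its square root. *)
Lemma derivable_kappa2 s : U s -> k2 s != 0 -> derivable k2 s 1.
Proof.
move=> Us k20; have [Is /= k10] := Us.
have dk1 := is_derive_kappa1 Us.
pose q t := (dot (b 3 t) (b 3 t) - k1^`()%classic t ^+ 2 - k1 t ^+ 4)
  * (k1 t ^+ 2)^-1.
have k2E t : U t -> Num.sqrt (q t) = k2 t.
  move=> Ut; have [_ /= k1t] := Ut; rewrite /q sqr_norm_jerk//.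
  rewrite (_ : _ * _ = k2 t ^+ 2); last first.
    by move: (k1 t) (k1^`()%classic t) (k2 t) k1t => x dx y x0; field.
  by rewrite sqrtr_sqr ger0_norm// sqrtr_ge0.
have q_gt0 : 0 < q s by rewrite -sqrtr_gt0 k2E// lt_def k20 sqrtr_ge0.
have k1s0 : k1 s ^+ 2 != 0 by rewrite sqrf_eq0.
have [] // := is_derive_on_congr open_kappa1_neq0 k2E Us
  (@is_derive_sqrt _ q s _ q_gt0 (is_derive_mul
     (is_deriveB (is_deriveB (is_derive_smooth_dot 3 3 beta_smooth Is)
        (is_derive_exprn 2 (is_derive2_kappa1 Us)))
        (is_derive_exprn 4 dk1))
     (@is_derive_inv _ (fun t => k1 t ^+ 2) s _ k1s0 (is_derive_exprn 2 dk1)))).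
Qed.

Lemma frenet_equation_jerk : frenet_equation I beta <->
  forall s, I s -> dot (b 4 s) (b 3 s) = 0.
Proof.
split=> [feq s Is|jerk]; last first.
  rewrite /frenet_equation => s Is k10 dk2.
  by rewrite (frenet_expression (conj Is k10) dk2); exact: jerk.
apply/eqP/negPn/negP => d0.
(* The open set where orthogonality fails; it contains [s]. *)
pose V := I `&` [set t | dot (b 4 t) (b 3 t) != 0].
have Vopen : open V.
  rewrite openE => t [It /= dt0].
  have dc : {for t, continuous (fun x => dot (b 4 x) (b 3 x))}.
    apply: derivable1_continuous.
    by have [] := is_derive_smooth_dot 4 3 beta_smooth It.
  by near=> x; split; near: x;
    [exact: open_near I_open It|exact: cvgr_neq0 dc dt0].
have Vs : V s by [].
(* If [kappa1] vanishes on all of [V], then [beta'' = 0] on [V], so [beta''' = 0] at [s],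
   contradicting [d0]. *)
have [[t [Vt k1t]]|noU] := pselect (exists t, V t /\ k1 t != 0); last first.
  have b20 t : V t -> cst 0 t = b 2 t.
    move=> Vt; apply/esym/eqP; rewrite -kappa1_eq0.
    by apply: contrapT => /negP k1t; apply: noU; exists t.
  have b30 := is_derive_on_unique Vopen b20 Vs (is_derive_cst _ _ _)
    (is_derive_smooth 2 beta_smooth Is).
  move/eqP: d0; apply.
  exact: etrans (congr1 (dot _) (esym b30)) (dot0r _).
(* Where [kappa2] is differentiable, the Frenet equation forces the orthogonality that [V]
   excludes. *)
have nd x : (V `&` U) x -> ~ derivable k2 x 1.
  move=> [[_ /= /negP dx] Ux] dk2; apply: dx; apply/eqP.
  apply: etrans (esym (frenet_expression Ux dk2)) _.
  by case: Ux => Ix k1x; exact: feq Ix k1x dk2.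
have VUopen : open (V `&` U) by exact: openI Vopen open_kappa1_neq0.
have VUt : (V `&` U) t by split=> //; split=> //; case: Vt.
(* By contraposition of [derivable_kappa2], [kappa2] is zero on the open set [V] intersected with
   [U], hence differentiable there after all, against [nd]. *)
have k20 x : (V `&` U) x -> cst 0 x = k2 x.
  move=> VUx; apply/esym/eqP/negPn/negP => k2x.
  exact: (nd x VUx) (derivable_kappa2 VUx.2 k2x).
apply: (nd t VUt).
by have [] := is_derive_on_congr VUopen k20 VUt (is_derive_cst _ _ _).
Unshelve. all: by end_near. Qed.

End frenet_curvatures.

(** * Geometry of an oriented plane spanned by an orthonormal pair *)

Section plane_geometry.
Context {R : realType} {m : nat} (u v : 'rV[R]_m).
Hypothesis uv : orthonormal_pair u v.
Implicit Types x y z : 'rV[R]_m.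

(* [seq.rot] would otherwise shadow the rotation. *)
Local Notation rot := Defs.rot.

(** The span of [u] and [v], encoded as equality with the orthogonal projection, so that the
    coordinates are explicit. *)
Definition in_plane x : Prop := x = dot x u *: u + dot x v *: v.

Lemma orthonormal_dot :
  [/\ dot u u = 1, dot v v = 1, dot u v = 0 & dot v u = 0].
Proof.
by case: uv => u1 v1 uv0; rewrite -!sqr_enorm u1 v1 expr1n uv0 dotC uv0.
Qed.

Lemma dot_in_plane x y : in_plane y ->
  dot x y = dot x u * dot y u + dot x v * dot y v.
Proof. by move=> {1}->; rewrite dotDr !dotZr; ring. Qed.

Lemma dot_rot x y : dot y (rot u v x) = dot x u * dot y v - dot x v * dot y u.
Proof. by rewrite dotDr dotNr !dotZr. Qed.

Lemma dot_rot_self x : dot x (rot u v x) = 0.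
Proof. by rewrite dot_rot; ring. Qed.

Lemma rotZ (a : R) x : rot u v (a *: x) = a *: rot u v x.
Proof. by rewrite /rot !dotZl scalerBr !scalerA. Qed.

Lemma rot_rot x : in_plane x -> rot u v (rot u v x) = - x.
Proof.
move=> {2}->; have [uu vv uv0 vu0] := orthonormal_dot.
rewrite {1}/rot !(dotC (rot _ _ _)) !dot_rot uu vv uv0 vu0.
by apply/rowP => j; rewrite !mxE; ring.
Qed.

Lemma enorm_rot x : in_plane x -> enorm (rot u v x) = enorm x.
Proof.
move=> xP; have [uu vv uv0 vu0] := orthonormal_dot; congr Num.sqrt.
rewrite dot_rot !(dotC (rot _ _ _)) !dot_rot uu vv uv0 vu0.
by rewrite (dot_in_plane x xP); ring.
Qed.

Lemma in_plane_decomposition x z : in_plane x -> in_plane z -> dot x x = 1 ->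
  z = dot z x *: x + dot z (rot u v x) *: rot u v x.
Proof.
move=> xP zP; rewrite (dot_in_plane x xP) (dot_in_plane z xP) dot_rot => x1.
have xE j : x 0 j = dot x u * u 0 j + dot x v * v 0 j.
  by rewrite {1}xP !mxE.
apply/rowP => j; rewrite !mxE xE {1}zP !mxE.
move: (dot x u) (dot x v) (dot z u) (dot z v) x1 => a b c d ab1.
(* Multiplying the left side by [1 = a * a + b * b] makes the equality a polynomial identity. *)
by rewrite -[LHS]mul1r -ab1; ring.
Qed.

Lemma dot_in_plane_decomposition x z :
  in_plane x -> in_plane z -> dot x x = 1 ->
  dot z z = dot z x ^+ 2 + dot z (rot u v x) ^+ 2.
Proof.
move=> xP zP x1.
rewrite {2}(in_plane_decomposition xP zP x1) dotDr !dotZr.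
by rewrite !expr2.
Qed.

(** In the orthonormal frame formed by [x] and its rotation, [y] has only a normal component, so the
    tangential component of [z] is minus its square. For the derivatives of a curve, the normal
    components of [y] and [z] are the curvature and its derivative. *)
Lemma dot_in_plane_jerk x y z :
  in_plane x -> in_plane y -> in_plane z ->
  dot x x = 1 -> dot x y = 0 -> dot x z = - dot y y ->
  dot z z = dot z (rot u v x) ^+ 2 + dot y (rot u v x) ^+ 4.
Proof.
move=> xP yP zP x1 xy xz; rewrite (dot_in_plane_decomposition xP zP x1) dotC xz.
by rewrite (dot_in_plane_decomposition xP yP x1) (dotC y x) xy; ring.
Qed.

Lemma is_derive_dot_scale (f : R -> 'rV[R]_m) (w w' : 'rV[R]_m) (s : R) df :
  is_derive s 1 f df ->
  is_derive s 1 (fun t => dot (f t) w *: w') (dot df w *: w').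
Proof.
move=> hf; apply: is_derive_eq (is_derive_scale
  (is_derive_dot hf (is_derive_cst w _ _)) (is_derive_cst w' _ _)) _.
by rewrite dot0r scaler0 !addr0.
Qed.

Lemma is_derive_rot (f : R -> 'rV[R]_m) (s : R) df :
  is_derive s 1 f df ->
  is_derive s 1 (fun t => rot u v (f t)) (rot u v df).
Proof.
by move=> hf; exact: is_deriveB (is_derive_dot_scale u v hf)
                                (is_derive_dot_scale v u hf).
Qed.

End plane_geometry.

(** * Intermediate values on an interval *)

Lemma is_interval_IVT {R : realType} (I : set R) (f : R -> R) (y s t : R) :
  is_interval I -> (forall x, I x -> {for x, continuous f}) ->
  I s -> I t -> f s <= y <= f t -> exists2 c, I c & f c = y.
Proof.
move=> iI fc Is It /andP[sy yt].
have ivt a b : I a -> I b -> a <= b ->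
    Num.min (f a) (f b) <= y <= Num.max (f a) (f b) -> exists2 c, I c & f c = y.
  move=> Ia Ib ab yab.
  have Iab x : x \in `[a, b] -> I x.
    by rewrite in_itv => /= xab; exact: iI xab.
  have [|c /Iab Ic fcy] := IVT ab _ yab; last by exists c.
  by apply: continuous_in_subspaceT => x /set_mem /Iab; exact: fc.
have [st|/ltW ts] := leP s t; [apply: (ivt s t)|apply: (ivt t s)] => //.
  by rewrite ge_min le_max sy yt orbT.
by rewrite ge_min le_max sy yt orbT.
Qed.

(** The continuous function [f ^ n] takes no values but [0] and [c], and [c > 0] since [n] is even.
    If both were taken, so would be [c / 2]. *)
Lemma interval_fixed_power_neq0 {R : realType} (I : set R) (f : R -> R)
    (c s : R) (n : nat) :
  (0 < n)%N -> ~~ odd n -> is_interval I ->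
  (forall x, I x -> {for x, continuous f}) ->
  (forall x, I x -> f x != 0 -> f x ^+ n = c) ->
  I s -> f s != 0 -> forall t, I t -> f t != 0.
Proof.
move=> n0 n_even iI fc fnc Is fs0 t It; apply/negP => /eqP ft0.
have c_gt0 : 0 < c.
  by rewrite -(fnc s Is fs0) lt_def expf_neq0//= exprn_even_ge0.
have gc x : I x -> {for x, continuous (fun y => f y ^+ n)}.
  move=> Ix; apply: (@continuous_comp _ _ _ f (fun y => y ^+ n)).
    exact: fc.
  exact: exprn_continuous.
have [|z Iz fz] := is_interval_IVT (y := c / 2) iI gc It Is.
  by rewrite (fnc s Is fs0) ft0 expr0n gtn_eqF//=; lra.
have fz0 : f z != 0.
  by apply/eqP => fz0; move: fz; rewrite fz0 expr0n gtn_eqF//=; lra.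
by have := fnc z Iz fz0; lra.
Qed.

(** * Signed curvature of plane curves *)

Section planar_curves.
Context {R : realType} {m : nat} (I : set R) (beta : R -> 'rV[R]_m)
  (p u v : 'rV[R]_m).
Hypotheses (I_open : open I) (I_itv : is_interval I)
  (beta_smooth : smooth_on I beta) (beta_arclength : arclength_on I beta)
  (uv : orthonormal_pair u v) (planar : beta @` I `<=` affine_plane p u v).

Local Notation b n := (beta^`(n)%classic).
Local Notation rot := Defs.rot.
Local Notation k := (plane_curvature u v beta).

(** The component [res] orthogonal to the plane commutes with differentiation. Along the curve it is
    the constant [res p], so it vanishes on every derivative of positive order. *)
Lemma in_plane_derivative n s : I s -> in_plane u v (b n.+1 s).
Proof.
pose res x := x - dot x u *: u - dot x v *: v.
have [uu vv uv0 vu0] := orthonormal_dot uv.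
have dres i t : I t -> is_derive t 1 (fun x => res (b i x)) (res (b i.+1 t)).
  move=> It; have db := is_derive_smooth i beta_smooth It.
  exact: is_deriveB (is_deriveB db (is_derive_dot_scale u u db))
                    (is_derive_dot_scale v v db).
suff [c resc] : exists c, forall t, I t -> res (b n t) = c.
  move=> Is.
  have /eqP := is_derive_on_unique I_open resc Is (dres n s Is)
    (is_derive_cst _ _ _).
  by rewrite /res -addrA -opprD subr_eq0 => /eqP.
elim: n => [|n [c resc]].
  exists (res p) => t It.
  have [x [y bt]] : affine_plane p u v (beta t) by apply: planar; exists t.
  rewrite derive1n0 bt /res !(dotDl, dotZl) uu vv uv0 vu0.
  by apply/rowP => j; rewrite !mxE; ring.
exists 0 => t It.
exact: is_derive_on_unique I_open resc It (dres n t It) (is_derive_cst _ _ _).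
Qed.

Lemma is_derive_dot_rot i j s : I s ->
  is_derive s 1 (fun t => dot (b i t) (rot u v (b j t)))
    (dot (b i.+1 s) (rot u v (b j s)) + dot (b i s) (rot u v (b j.+1 s))).
Proof.
move=> Is; exact: is_derive_dot (is_derive_smooth i beta_smooth Is)
  (is_derive_rot u v (is_derive_smooth j beta_smooth Is)).
Qed.

Lemma is_derive_curvature s : I s ->
  is_derive s 1 k (dot (b 3 s) (rot u v (b 1 s))).
Proof.
move=> Is; apply: is_derive_eq (is_derive_dot_rot 2 1 Is) _.
exact: etrans (congr1 (+%R _) (dot_rot_self u v (b 2 s))) (addr0 _).
Qed.

Lemma derive_curvature s : I s ->
  k^`()%classic s = dot (b 3 s) (rot u v (b 1 s)).
Proof. by move=> Is; exact: is_derive_derive1 (is_derive_curvature Is). Qed.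

Lemma is_derive2_curvature s : I s -> is_derive s 1 k^`()%classic
  (dot (b 4 s) (rot u v (b 1 s)) + dot (b 3 s) (rot u v (b 2 s))).
Proof.
move=> Is; exact: is_derive_on_congr I_open
  (fun t It => esym (derive_curvature It)) Is (is_derive_dot_rot 3 1 Is).
Qed.

Lemma derive2_curvature s : I s -> k^`(2)%classic s =
  dot (b 4 s) (rot u v (b 1 s)) + dot (b 3 s) (rot u v (b 2 s)).
Proof. by move=> Is; exact: is_derive_derive1 (is_derive2_curvature Is). Qed.

Lemma derivable_derive2_curvature s : I s -> derivable k^`(2)%classic s 1.
Proof.
move=> Is; have [] // := is_derive_on_congr I_open
  (fun t It => esym (derive2_curvature It)) Is
  (is_deriveD (is_derive_dot_rot 4 1 Is) (is_derive_dot_rot 3 2 Is)).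
Qed.

Lemma acceleration_curvature s : I s -> b 2 s = k s *: rot u v (b 1 s).
Proof.
move=> Is; have := in_plane_decomposition (in_plane_derivative 0 Is)
  (in_plane_derivative 1 Is) (dot_velocity beta_arclength Is).
rewrite dotC (dot_velocity_acceleration I_open beta_smooth beta_arclength Is).
by rewrite scale0r add0r.
Qed.

Lemma dot_jerk_curvature s : I s ->
  dot (b 3 s) (b 3 s) = k^`()%classic s ^+ 2 + k s ^+ 4.
Proof.
move=> Is; rewrite derive_curvature//.
exact: dot_in_plane_jerk (in_plane_derivative 0 Is) (in_plane_derivative 1 Is)
  (in_plane_derivative 2 Is) (dot_velocity beta_arclength Is)
  (dot_velocity_acceleration I_open beta_smooth beta_arclength Is)
  (dot_velocity_jerk I_open beta_smooth beta_arclength Is).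
Qed.

Lemma dot_snap_jerk_curvature s : I s -> dot (b 4 s) (b 3 s) =
  k^`()%classic s * (k^`(2)%classic s + 2 * k s ^+ 3).
Proof.
move=> Is.
have dk := is_derive_curvature Is; rewrite -(derive_curvature Is) in dk.
have ddk := is_derive2_curvature Is; rewrite -(derive2_curvature Is) in ddk.
have := is_derive_on_unique I_open dot_jerk_curvature Is
  (is_derive_dot_self (is_derive_smooth 3 beta_smooth Is))
  (is_deriveD (is_derive_exprn 2 ddk) (is_derive_exprn 4 dk)).
rewrite /=; move: (k s) (k^`()%classic s) (k^`(2)%classic s) (dot _ _).
move=> x dx ddx d; lra.
Qed.

(** The center of curvature [q = beta + N / k0] is fixed: [N = rot beta'] has derivative
    [k0 rot (rot beta') = - k0 beta']. The radius is [|1 / k0|]. *)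
Lemma constant_curvature_circle k0 s0 : k0 != 0 -> I s0 ->
  (forall s, I s -> k s = k0) -> part_of_circle I beta.
Proof.
move=> k00 Is0 kk0; pose q t := beta t + k0^-1 *: rot u v (b 1 t).
have dq t : I t -> is_derive t 1 q 0.
  move=> It; apply: is_derive_eq (is_deriveD (is_derive_smooth 0 beta_smooth It)
    (is_deriveZ _ (is_derive_rot u v (is_derive_smooth 1 beta_smooth It)))) _.
  have r2 : rot u v (b 2 t) = - (k0 *: b 1 t).
    rewrite acceleration_curvature// rotZ.
    by rewrite (rot_rot uv (in_plane_derivative 0 It)) kk0// scalerN.
  rewrite r2 scalerN scalerA mulVf// scale1r.
  exact: subrr.
exists (q s0), u, v, `|k0^-1|; split=> //; first by rewrite normr_gt0 invr_eq0.
move=> _ [t It <-].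
have betaE : beta t = q s0 - k0^-1 *: rot u v (b 1 t).
  by rewrite (is_derive_on_constant_rV I_itv dq Is0 It) addrK.
split.
  (* The coordinates of [- N / k0] in the pair [(u, v)]. *)
  exists (k0^-1 * dot (b 1 t) v), (- (k0^-1 * dot (b 1 t) u)).
  by rewrite betaE /rot; apply/rowP => j; rewrite !mxE; ring.
rewrite /= betaE addrC addKr -scaleNr enormZ normrN.
by rewrite (enorm_rot uv (in_plane_derivative 0 It)) (beta_arclength It) mulr1.
Qed.

Lemma jerk_curvature_equation : ~ part_of_circle I beta ->
  (forall s, I s -> dot (b 4 s) (b 3 s) = 0) <->
  (forall s, I s -> k^`(2)%classic s = - (2 * k s ^+ 3)).
Proof.
move=> not_circle; split=> [jerk|kE s Is]; last first.
  by rewrite dot_snap_jerk_curvature// kE// addNr mulr0.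
pose E s := k^`(2)%classic s + 2 * k s ^+ 3.
have kE s : I s -> k^`()%classic s * E s = 0.
  by move=> Is; rewrite -dot_snap_jerk_curvature//; exact: jerk.
suff E0 s : I s -> E s = 0.
  by move=> s Is; apply/eqP; rewrite -addr_eq0; apply/eqP; exact: E0.
move=> Is; apply/eqP/negPn/negP => Es0; apply: not_circle.
have Ec t : I t -> {for t, continuous E}.
  move=> It; apply: derivable1_continuous.
  have d2 := derivable_is_derive1 (derivable_derive2_curvature It).
  by have [] // := is_deriveD d2 (is_deriveZ 2
    (is_derive_exprn 3 (is_derive_curvature It))).
pose V := I `&` [set t | E t != 0].
have Vopen : open V.
  rewrite openE => t [It /= Et0].
  by near=> x; split; near: x; [exact: open_near I_open It|
                                exact: cvgr_neq0 (Ec t It) Et0].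
have dk0 t : V t -> k^`()%classic t = 0.
  by move=> [It /= Et0]; have /eqP := kE t It; rewrite mulf_eq0 (negPf Et0) orbF
    => /eqP.
(* On the open set [V], [k'] vanishes identically, so [k''] does too. *)
have EV t : V t -> E t = 2 * k t ^+ 3.
  move=> Vt; rewrite /E derive2_curvature; last by case: Vt.
  have [It _] := Vt.
  rewrite (is_derive_on_unique Vopen dk0 Vt (is_derive2_curvature It)
    (is_derive_cst _ _ _)).
  by rewrite add0r.
pose C := dot (b 3 s) (b 3 s).
have jerkC t : I t -> dot (b 3 t) (b 3 t) = C.
  move=> It; apply: (@is_derive_on_constant R I
    (fun x => dot (b 3 x) (b 3 x)) I_itv _ t s It Is) => x Ix.
  apply: is_derive_eq
    (is_derive_dot_self (is_derive_smooth 3 beta_smooth Ix)) _.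
  exact: etrans (congr1 ( *%R 2) (jerk x Ix)) (mulr0 2).
have kC t : V t -> C = k t ^+ 4.
  move=> Vt; have [It _] := Vt; apply: etrans (esym (jerkC t It)) _.
  by apply: etrans (dot_jerk_curvature It) _; rewrite dk0// expr0n add0r.
(* With [E = 2 k^3] and [C = k^4] on [V], [E^4 = 16 k^12], which no longer involves [k]. *)
have E4 t : V t -> E t ^+ 4 = 16 * C ^+ 3.
  by move=> Vt; rewrite EV// (kC t Vt); ring.
(* The nonzero values of [E^4] being all equal, [E] is nonzero throughout [I], and thus [k' = 0]
   throughout [I]. *)
have EN0 t : I t -> E t != 0.
  apply: (interval_fixed_power_neq0 (n := 4) isT isT I_itv Ec _ Is Es0).
  move=> x Ix Ex0.
  by apply: E4; split.
have dk0I t : I t -> k^`()%classic t = 0.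
  by move=> It; exact: dk0 (conj It (EN0 t It)).
have ks0 : k s != 0.
  apply/eqP => ks0; move/eqP: (Es0); apply.
  by rewrite (EV s (conj Is Es0)) ks0 expr0n mulr0.
apply: (constant_curvature_circle ks0 Is) => t It.
apply: (@is_derive_on_constant R I k I_itv _ t s It Is) => x Ix.
apply: is_derive_eq (is_derive_curvature Ix) _.
by rewrite -derive_curvature ?dk0I.
Unshelve. all: by end_near. Qed.

End planar_curves.

Unset Implicit Arguments.

Theorem proposition1p2 (R : realType) (m : nat) (I : set R)
    (beta : R -> 'rV[R]_m)
    (I_open : open I) (I_itv : is_interval I)
    (beta_smooth : smooth_on I beta)
    (beta_arclength : arclength_on I beta)
    (not_line : ~ part_of_line I beta)
    (not_circle : ~ part_of_circle I beta) :
  (harmonic_laplace I beta <-> frenet_equation I beta) /\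
  (forall p u v : 'rV[R]_m,
     orthonormal_pair u v -> beta @` I `<=` affine_plane p u v ->
     let k := plane_curvature u v beta in
     harmonic_laplace I beta <->
       (forall s, I s -> k^`(2)%classic s = - (2 * k s ^+ 3))).
Proof.
have harmonicE := harmonic_laplaceE I_open beta_smooth.
split=> [|p u v uv planar k]; apply: (iff_trans harmonicE).
  exact: iff_sym (frenet_equation_jerk I_open beta_smooth beta_arclength).
exact: jerk_curvature_equation I_open I_itv beta_smooth beta_arclength uv planar
  not_circle.
Qed.
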